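(* Let $\mathfrak g$ be a basic classical Lie superalgebra, let $q$ be generic, let $\mathcal A\subset U_q(\mathfrak g)^\circ$ be the superalgebra of functions on a quantum supergroup associated with $U_q(\mathfrak g)$, let $\mathcal P:U_q(\mathfrak g)^\circ\to U_q(\mathfrak g_0)^\circ$ be the restriction map, and let $\int_0$ be the (unique up to scalar multiples) left integral on $\mathcal A_e=\mathcal P(\mathcal A)$. Let $K=\{u\in U_q(\mathfrak g_0):\varepsilon(u)=0\}$ and $J=U_q(\mathfrak g)K$, and let $z\in U_q(\mathfrak g)$ be such that $z+J$ is an invariant of the left $U_q(\mathfrak g)$-module $U_q(\mathfrak g)/J$, i.e. $x(z+J)=\varepsilon(x)z+J$ for all $x\in U_q(\mathfrak g)$. Then $\int=\nu(z)\cdot(\int_0\circ\mathcal P|_{\mathcal A})$ is a left integral on $\mathcal A$ that does not depend on the representative $z$ of $z+J$.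
   Context: Everything is over $\mathbb C$ and $\mathbb Z_2$-graded, with the super sign rule; $[x]$ is the degree of a homogeneous element. $q\in\mathbb C^\times$ generic means in particular not a root of unity. $U_q(\mathfrak g)$ is the Drinfeld–Jimbo quantum superalgebra of $\mathfrak g$, a Hopf superalgebra with counit $\varepsilon$, defined with respect to the distinguished simple root system of $\mathfrak g$ (only one odd simple root). $U_q(\mathfrak g_0)\subset U_q(\mathfrak g)$ is the Hopf subalgebra generated by all Cartan generators and the even simple generators (i.e. the odd simple generators are removed but the corresponding Cartan generator is retained); $\mathfrak g_0\subset\mathfrak g$ is a reductive Lie algebra. The finite dual $\mathcal U^\circ\subset\mathcal U^*$ of a Hopf superalgebra $\mathcal U$ consists of the matrix elements of finite-dimensional graded representations, with Hopf superalgebra structure obtained by transposition: $\langle ab,x\rangle=\langle a\otimes b,\Delta(x)\rangle$, $\langle\Delta(a),x\otimes y\rangle=\langle a,xy\rangle$, where $\langle a\otimes b,x\otimes y\rangle=(-1)^{[b][x]}\langle a,x\rangle\langle b,y\rangle$. The superalgebra of functions $\mathcal A$ on a quantum supergroup associated with $U_q(\mathfrak g)$ is a sub-Hopf-superalgebra of $U_q(\mathfrak g)^\circ$ that is dense in $U_q(\mathfrak g)^*$ (for every $0\ne x\in U_q(\mathfrak g)$ there is $a\in\mathcal A$ with $\langle a,x\rangle\ne 0$), generated by matrix elements of some finite-dimensional irreducible representations. Standing assumption: $\mathcal A_e=\mathcal P(\mathcal A)$ has a Peter–Weyl type basis of matrix elements of finite-dimensional irreducible representations of $U_q(\mathfrak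 g_0)$, and $\int_0:\mathcal A_e\to\mathbb C$ is the left integral (also right invariant, non-vanishing on $1_{\mathcal A_e}$) annihilating the matrix elements of non-trivial irreducible representations. The map $\nu:U_q(\mathfrak g)\to\mathcal A^\circ\subset\mathcal A^*$ is $\langle\nu(x),a\rangle=(-1)^{[x][a]}\langle a,x\rangle$, and $\langle f\cdot g,a\rangle=\langle f\otimes g,\Delta(a)\rangle$ is the product in $\mathcal A^*$. A left integral on a Hopf superalgebra $\mathcal B$ is a linear form $\int$ on $\mathcal B$ with $(\mathrm{id}\otimes\int)\Delta(b)=1_{\mathcal B}\int(b)$ for all $b\in\mathcal B$. *)

(* Defs.v *)
(* MathComp world: MathComp-Analysis for realType and the exponential, and
   real-closed for the complex numbers R[i]. *)
From mathcomp Require Export all_boot all_order all_algebra.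
From mathcomp Require Export boolp classical_sets functions reals sequences trigo.
From mathcomp Require Export complex.
Set Implicit Arguments.
Unset Strict Implicit.
Unset Printing Implicit Defensive.
Import Order.TTheory GRing.Theory Num.Theory.
Local Open Scope classical_set_scope.
Local Open Scope ring_scope.

(******************************************************************************)
(* Tensors.  MathComp has no tensor product of modules, so an element of      *)
(* U (x) V is represented by a formal sum of pure tensors                     *)
(*    [:: (u1, v1); ...; (un, vn)]   standing for   \sum_i ui (x) vi,         *)
(* and two formal sums denote the same tensor iff all bilinear maps agree on  *)
(* them (the universal property of U (x) V).                                  *)
(******************************************************************************)

Section Tensors.
Variable K : fieldType.

Definition bilin (U V W : lmodType K) (b : U -> V -> W) : Prop :=
  (forall u, linear (b u)) /\ (forall v, linear (b^~ v)).

Definition trilin (U V T W : lmodType K) (t : U -> V -> T -> W) : Prop :=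
  [/\ forall u v, linear (t u v), forall u x, linear (fun v => t u v x)
    & forall v x, linear (fun u => t u v x)].

Definition tens_eq (U V : lmodType K) (s t : seq (U * V)) : Prop :=
  forall (W : lmodType K) (b : U -> V -> W), bilin b ->
    \sum_(u <- s) b u.1 u.2 = \sum_(u <- t) b u.1 u.2.

Definition tens3_eq (U V T : lmodType K) (s t : seq (U * V * T)) : Prop :=
  forall (W : lmodType K) (b : U -> V -> T -> W), trilin b ->
    \sum_(u <- s) b u.1.1 u.1.2 u.2 = \sum_(u <- t) b u.1.1 u.1.2 u.2.

End Tensors.

(* A Hopf superalgebra over K.  The Z_2-grading is given by the projections
   [par false] and [par true] onto the even and the odd part; x is homogeneous
   of degree d iff [par d x = x].  [comult x] is a formal sum representing the
   coproduct of x. *)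
Record hopfSuperalgebra (K : fieldType) := HopfSuperalgebra {
  carrier :> algType K;
  par : bool -> carrier -> carrier;
  comult : carrier -> seq (carrier * carrier);
  counit : carrier -> K;
  antipode : carrier -> carrier;
  par_linear : forall d, linear (par d);
  par_proj : forall c d x, par c (par d x) = if c == d then par d x else 0;
  par_sum : forall x, par false x + par true x = x;
  par_one : par false 1 = 1;
  par_mul : forall c d x y, par c x = x -> par d y = y ->
    par (c (+) d) (x * y) = x * y;
  comult_linear : forall (a : K) x y,
    tens_eq (comult (a *: x + y))
      ([seq (a *: u.1, u.2) | u <- comult x] ++ comult y);
  comult_par : forall d x,
    tens_eq (comult (par d x))
      [seq (par c u.1, par (c (+) d) u.2) | u <- comult x, c <- [:: false; true]];
  comult_one : tens_eq (comult 1) [:: (1, 1)];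
  comult_mul : forall x y,
    tens_eq (comult (x * y))
      [seq ((-1) ^+ (cd.1 && cd.2) *: (uv.1.1 * par cd.2 uv.2.1),
            par cd.1 uv.1.2 * uv.2.2)
      | uv <- [seq (u, v) | u <- comult x, v <- comult y],
        cd <- [seq (c, d) | c <- [:: false; true], d <- [:: false; true]]];
  comult_coassoc : forall x,
    tens3_eq [seq (v.1, v.2, u.2) | u <- comult x, v <- comult u.1]
             [seq (u.1, v.1, v.2) | u <- comult x, v <- comult u.2];
  counit_linear : forall (a : K) x y,
    counit (a *: x + y) = a * counit x + counit y;
  counit_par : forall x, counit (par false x) = counit x;
  counit_one : counit 1 = 1;
  counit_mul : forall x y, counit (x * y) = counit x * counit y;
  counit_l : forall x, \sum_(u <- comult x) counit u.1 *: u.2 = x;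
  counit_r : forall x, \sum_(u <- comult x) counit u.2 *: u.1 = x;
  antipode_linear : linear antipode;
  antipode_par : forall d x, antipode (par d x) = par d (antipode x);
  antipode_l : forall x, \sum_(u <- comult x) antipode u.1 * u.2 = (counit x)%:A;
  antipode_r : forall x, \sum_(u <- comult x) u.1 * antipode u.2 = (counit x)%:A
}.

Arguments par {K h} d x.
Arguments comult {K h} x.
Arguments counit {K h} x.
Arguments antipode {K h} x.

(* S is a subspace containing [one] and closed under [mul]. *)
Definition subalgebra (K : fieldType) (T : Type) (lin : K -> T -> T -> T)
    (one : T) (mul : T -> T -> T) (S : set T) : Prop :=
  [/\ S one, forall a x y, S x -> S y -> S (lin a x y)
    & forall x y, S x -> S y -> S (mul x y)].

Section HopfSuperalgebras.
Variable K : fieldType.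
Implicit Types H L : hopfSuperalgebra K.

Definition generated_subalgebra H (G : set H) : set H :=
  smallest (subalgebra (fun (a : K) x y => a *: x + y) 1 *%R) G.

Definition hopf_morphism H L (phi : {lrmorphism H -> L}) : Prop :=
  [/\ forall d x, phi (par d x) = par d (phi x),
      forall x, tens_eq [seq (phi u.1, phi u.2) | u <- comult x]
                        (comult (phi x)),
      forall x, counit (phi x) = counit x
    & forall x, phi (antipode x) = antipode (phi x)].

(* <f (x) g, v (x) w> = (-1)^([g][v]) <f, v> <g, w>, extended bilinearly to
   inhomogeneous arguments; g may be replaced by its component of degree j in
   the term involving the component of degree j of w. *)
Definition kpair (V W : Type) (pV : bool -> V -> V) (pW : bool -> W -> W)
    (f : V -> K) (g : W -> K) (v : V) (w : W) : K :=
  \sum_(i : bool) \sum_(j : bool) (-1) ^+ (i && j) * (f (pV i v) * g (pW j w)).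

(* Elements of the dual of H are plain functions [H -> K]; those considered
   below are linear because they lie in the finite dual. *)

(* The component of degree d of a, i.e., the form that agrees with a in degree
   d and vanishes on the other component. *)
Definition dpar H (d : bool) (a : H -> K) : H -> K := a \o par d.

Definition dmul H (a b : H -> K) : H -> K :=
  fun x => \sum_(u <- comult x) kpair par par a b u.1 u.2.

(* s is an element of B (x) B representing the coproduct of a, which is the
   transpose of the product of H. *)
Definition represents_dcomul H (B : set (H -> K)) (a : H -> K)
    (s : seq ((H -> K) * (H -> K))) : Prop :=
  (forall u, u \in s -> B u.1 /\ B u.2) /\
  forall x y : H, \sum_(u <- s) kpair par par u.1 u.2 x y = a (x * y).

Definition dcomul H (B : set (H -> K)) (a : H -> K) :
    seq ((H -> K) * (H -> K)) := xget [::] (represents_dcomul B a).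

(* Finite-dimensional graded representations, on column vectors; the i-th basis
   vector is homogeneous of degree [rep_par i]. *)
Record super_rep H := SuperRep {
  rep_dim : nat;
  rep_par : 'I_rep_dim -> bool;
  rep_act : H -> 'M[K]_rep_dim;
  rep_linear : linear rep_act;
  rep_one : rep_act 1 = 1%:M;
  rep_mul : forall x y, rep_act (x * y) = rep_act x *m rep_act y;
  rep_graded : forall d x i j, par d x = x ->
    rep_par i (+) rep_par j != d -> rep_act x i j = 0
}.

(* A subspace of the column space is the row space of some W, acted upon by the
   transposed matrices; it is graded iff it is stable under the parity
   operator. *)
Definition irreducible_rep H (r : super_rep H) : Prop :=
  (0 < rep_dim r)%N /\
  forall W : 'M[K]_(rep_dim r),
    (W *m diag_mx (\row_i (-1) ^+ rep_par i) <= W)%MS ->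
    (forall x, W *m (rep_act r x)^T <= W)%MS ->
    W = 0 \/ row_full W.

Definition trivial_rep H (r : super_rep H) : Prop :=
  rep_dim r = 1%N /\ forall x, rep_act r x = (counit x)%:M.

Definition matrix_element H (r : super_rep H) (i j : 'I_(rep_dim r)) : H -> K :=
  fun x => rep_act r x i j.

Definition finite_dual H : set (H -> K) :=
  [set a | exists (r : super_rep H) (u : 'rV[K]_(rep_dim r))
             (v : 'cV[K]_(rep_dim r)),
             forall x, a x = (u *m rep_act r x *m v) 0 0].

(* Unit, counit, product, coproduct and antipode of the finite dual are the
   transposes of the counit, unit, coproduct, product and antipode of H. *)
Definition sub_hopf_superalgebra H (B : set (H -> K)) : Prop :=
  [/\ B `<=` finite_dual (H := H),
      subalgebra (fun (c : K) (a b : H -> K) => c \*o a \+ b)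
        counit (@dmul H) B,
      forall d a, B a -> B (dpar d a),
      forall a, B a -> exists s, represents_dcomul B a s
    & forall a, B a -> B (a \o antipode)].

Definition dense H (B : set (H -> K)) : Prop :=
  forall x : H, x != 0 -> exists2 a, B a & a x != 0.

Definition generated_by_irreducibles H (B : set (H -> K)) : Prop :=
  exists2 F : set (super_rep H), (forall r, F r -> irreducible_rep r) &
    B = smallest (subalgebra (fun (c : K) (a b : H -> K) => c \*o a \+ b)
                    counit (@dmul H))
          [set a | exists2 r, F r & exists i j, a = @matrix_element H r i j].

Definition function_superalgebra H (B : set (H -> K)) : Prop :=
  [/\ sub_hopf_superalgebra B, dense B & generated_by_irreducibles B].

Definition peter_weyl_basis H (B : set (H -> K)) : Prop :=
  exists (Lam : choiceType) (r : Lam -> super_rep H),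
    let comb (s : seq Lam)
        (c : forall l, 'I_(rep_dim (r l)) -> 'I_(rep_dim (r l)) -> K) : H -> K :=
      fun x => \sum_(l <- s) \sum_i \sum_j c l i j * rep_act (r l) x i j in
    [/\ forall l, irreducible_rep (r l),
        forall a, B a <-> exists s c, a = comb s c
      & forall s c, uniq s -> (forall x, comb s c x = 0) ->
          forall l, l \in s -> forall i j, c l i j = 0].

(* Linear forms on B are functions that are only required to be linear on B. *)
Definition linear_form_on H (B : set (H -> K)) (I : (H -> K) -> K) : Prop :=
  forall (c : K) a b, B a -> B b -> I (c \*o a \+ b) = c * I a + I b.

(* (id (x) I)(Delta b) = I(b) 1, evaluated at all x in H. *)
Definition left_integral H (B : set (H -> K)) (I : (H -> K) -> K) : Prop :=
  linear_form_on B I /\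
  forall b, B b -> forall x : H,
    \sum_(u <- dcomul B b) kpair (@dpar H) (@dpar H) (fun a => a x) I u.1 u.2
      = I b * counit x.

Definition right_integral H (B : set (H -> K)) (I : (H -> K) -> K) : Prop :=
  linear_form_on B I /\
  forall b, B b -> forall x : H,
    \sum_(u <- dcomul B b) I u.1 * u.2 x = I b * counit x.

(* The standing assumptions on the integral of the even part. *)
Definition even_integral H (B : set (H -> K)) (I : (H -> K) -> K) : Prop :=
  [/\ left_integral B I, right_integral B I, I counit != 0
    & forall r : super_rep H, irreducible_rep r -> ~ trivial_rep r ->
        (forall i j, B (@matrix_element H r i j)) ->
        forall i j, I (@matrix_element H r i j) = 0].

Definition dual_prod H (B : set (H -> K)) (f g : (H -> K) -> K) :
    (H -> K) -> K :=
  fun a => \sum_(u <- dcomul B a) kpair (@dpar H) (@dpar H) f g u.1 u.2.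

Definition nu H (x : H) : (H -> K) -> K :=
  fun a => \sum_(i : bool) \sum_(j : bool)
             (-1) ^+ (i && j) * dpar j a (par i x).

Definition restriction H0 H (iota : {lrmorphism H0 -> H}) (a : H -> K) :
  H0 -> K := a \o iota.

(* The left ideal H K0, where K0 is the kernel of the counit of H0. *)
Definition left_ideal_J H0 H (iota : {lrmorphism H0 -> H}) : set H :=
  [set y | exists2 s : seq (H * H0), (forall u, u \in s -> counit u.2 = 0) &
             y = \sum_(u <- s) u.1 * iota u.2].

(* z + J is an invariant of the left H-module H / J. *)
Definition invariant_mod_J H0 H (iota : {lrmorphism H0 -> H}) (z : H) : Prop :=
  forall x : H, left_ideal_J iota (x * z - counit x *: z).

End HopfSuperalgebras.

(******************************************************************************)
(* Basic classical Lie superalgebras (with nonzero odd part), following the   *)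
(* classification, and their distinguished simple root systems:               *)
(*   BC_A m n    sl(m+1|n+1), resp. psl(n+1|n+1) if m = n                     *)
(*   BC_B m n    osp(2m+1|2n)                                                 *)
(*   BC_C n      osp(2|2n-2)                                                  *)
(*   BC_D m n    osp(2m|2n)                                                   *)
(*   BC_D21 a    D(2,1;a)                                                     *)
(*   BC_F4, BC_G3                                                             *)
(******************************************************************************)

Inductive basic_classical (C : Type) : Type :=
| BC_A of nat & nat
| BC_B of nat & nat
| BC_C of nat
| BC_D of nat & nat
| BC_D21 of C
| BC_F4
| BC_G3.
Arguments BC_A {C}.
Arguments BC_B {C}.
Arguments BC_C {C}.
Arguments BC_D {C}.
Arguments BC_F4 {C}.
Arguments BC_G3 {C}.

Section CartanData.
Variable C : fieldType.
Implicit Type g : basic_classical C.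

Definition admissible g : Prop :=
  match g with
  | BC_A m n => (0 < m + n)%N
  | BC_B m n => (0 < n)%N
  | BC_C n => (1 < n)%N
  | BC_D m n => (1 < m)%N /\ (0 < n)%N
  | BC_D21 a => a != 0 /\ a != -1
  | BC_F4 | BC_G3 => True
  end.

Definition rank g : nat :=
  match g with
  | BC_A m n => m + n + 1
  | BC_B m n | BC_D m n => m + n
  | BC_C n => n
  | BC_D21 _ => 3
  | BC_F4 => 4
  | BC_G3 => 3
  end.

(* The position (counted from 0) of the odd simple root. *)
Definition odd_node g : nat :=
  match g with
  | BC_A m _ => m
  | BC_B _ n | BC_D _ n => n.-1
  | _ => 0
  end.

(* In the orthogonal basis b_0, b_1, ... of the dual of the Cartan subalgebra:
   A(m,n): eps_1, ..., eps_(m+1), delta_1, ..., delta_(n+1);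
   B(m,n), D(m,n): delta_1, ..., delta_n, eps_1, ..., eps_m;
   C(n): eps_1, delta_1, ..., delta_(n-1);
   with (eps_i, eps_i) = 1 and (delta_i, delta_i) = -1. *)
Definition basis_size g : nat :=
  match g with
  | BC_A m n => m + n + 2
  | BC_B m n | BC_D m n => m + n
  | BC_C n => n
  | _ => 0
  end.

Definition basis_norm g (p : nat) : C :=
  match g with
  | BC_A m n => if (p <= m)%N then 1 else -1
  | BC_B m n | BC_D m n => if (p < n)%N then -1 else 1
  | BC_C n => if p == 0%N then 1 else -1
  | _ => 0
  end.

(* The coefficient at b_p of the i-th simple root.  For B(m,n), the last simple
   root is the last basis vector because the term at b_(i+1) is out of range. *)
Definition simple_root g (i p : nat) : C :=
  match g with
  | BC_C n => if i.+1 == n then 2 * (p == i)%:R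
              else (p == i)%:R - (p == i.+1)%:R
  | BC_D m n => if i.+1 == (m + n)%N then (p == i)%:R + (p == i.-1)%:R
                else (p == i)%:R - (p == i.+1)%:R
  | _ => (p == i)%:R - (p == i.+1)%:R
  end.

(* The inner product (alpha_i, alpha_j) of simple roots.  The forms of F(4) and
   G(3) are normalized so that their values are integers. *)
Definition gram g (i j : nat) : C :=
  match g with
  | BC_D21 a => nth 0 (nth [::] [:: [:: 0; -1; -a];
                                    [:: -1; 2; 0];
                                    [:: -a; 0; 2 * a]] i) j
  | BC_F4 => nth 0 (nth [::] [:: [:: 0; -1; 0; 0];
                                 [:: -1; 2; -2; 0];
                                 [:: 0; -2; 4; -2];
                                 [:: 0; 0; -2; 4]] i) j
  | BC_G3 => nth 0 (nth [::] [:: [:: 0; -1; 0];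
                                 [:: -1; 2; -3];
                                 [:: 0; -3; 6]] i) j
  | _ => \sum_(p < basis_size g)
           basis_norm g p * simple_root g i p * simple_root g j p
  end.

End CartanData.

Section QuantumSuperalgebra.
Variable R : realType.
Local Notation C := (complex R).

Definition cexp (z : C) : C :=
  Complex (expR (complex.Re z) * cos (complex.Im z))
          (expR (complex.Re z) * sin (complex.Im z)).

(* q = exp h and q^c = exp (c h); non-integral exponents c occur only for
   D(2,1;a), all other values of the form being integers. *)
Definition qpow (h c : C) : C := cexp (c * h).

(* For D(2,1;a), generic includes that q^a and q^(2a) are no roots of unity
   either; for the other types the second condition follows from the first. *)
Definition generic (g : basic_classical C) (h : C) : Prop :=
  (forall k, (0 < k)%N -> qpow h 1 ^+ k != 1) /\
  (forall i j : 'I_(rank g), gram g i j != 0 ->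
     forall k, (0 < k)%N -> qpow h (gram g i j) ^+ k != 1).

Section Relations.
Variables (g : basic_classical C) (h : C) (B : algType C).
Local Notation idx := 'I_(rank g).
Implicit Types (e f k kinv x : idx -> B).

Definition is_odd (i : idx) : bool := i == odd_node g :> nat.

(* (ad_q x_i)^n x_j, where
     (ad_q x_i) y = x_i y - (-1)^([i][y]) q^(alpha_i, wt y) y x_i. *)
Fixpoint ad_iter x (i j : idx) (n : nat) : B :=
  if n is n'.+1 then
    let y := ad_iter x i j n' in
    x i * y - ((-1) ^+ (is_odd i * (is_odd j + n'))
               * qpow h (gram g i j + gram g i i *+ n')) *: (y * x i)
  else x j.

(* The quantum Serre relations for the e_i and likewise for the f_i.  The last
   one is the higher order relation for a subdiagram o--(x)--o of type sl(2|2)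
   or o--(x)=>o of type osp(3|4); for q = 1 it reads
   [[x_i, x_t], [x_t, x_j]] = 0. *)
Definition serre_relations x : Prop :=
  [/\ forall i : idx, gram g i i = 0 -> x i * x i = 0,
      forall (i j : idx) (n : nat), i != j -> gram g i i != 0 ->
        2 * gram g i j = - n%:R * gram g i i -> ad_iter x i j n.+1 = 0
    & forall t i j : idx, i != j -> gram g t t = 0 -> gram g i j = 0 ->
        gram g t i != 0 -> gram g t i + gram g t j = 0 ->
        x t * x i * x t * x j + x i * x t * x j * x t
        + x t * x j * x t * x i + x j * x t * x i * x t
        = (qpow h (gram g t i) + qpow h (- gram g t i))
          *: (x t * x i * x j * x t)].

(* The odd e_i, f_i enter through super commutators.  The denominator q - q^(-1)
   is used for all i (instead of q_i - q_i^(-1)), which amounts to rescaling the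
   f_i.  The last Cartan relation is void unless the form is degenerate on
   the root lattice, i.e. unless g = psl(n+1|n+1); in that case it imposes, as
   in g, that the central Cartan element of sl(n+1|n+1) is trivial. *)
Definition drinfeld_jimbo_relations e f k kinv : Prop :=
  [/\ [/\ forall i, k i * kinv i = 1 /\ kinv i * k i = 1,
          forall i j, k i * k j = k j * k i
        & forall c d : idx -> nat,
            (forall j : idx, \sum_i (c i)%:R * gram g i j
                             = \sum_i (d i)%:R * gram g i j) ->
            \prod_i k i ^+ c i = \prod_i k i ^+ d i],
      forall i j, k i * e j = qpow h (gram g i j) *: (e j * k i) /\
                  k i * f j = qpow h (- gram g i j) *: (f j * k i),
      forall i j, e i * f j - (-1) ^+ (is_odd i && is_odd j) *: (f j * e i)
        = if i == j then (qpow h 1 - qpow h (-1))^-1 *: (k i - kinv i) else 0,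
      serre_relations e
    & serre_relations f].

End Relations.

Section Quantum.
Variables (g : basic_classical C) (h : C) (U : hopfSuperalgebra C).
Variables (e f k kinv : 'I_(rank g) -> U).

(* U is U_q(g): the superalgebra presented by the generators e_i, f_i,
   k_i, k_i^(-1) and the relations above, with its Hopf structure. *)
Definition is_quantum_superalgebra : Prop :=
  [/\ drinfeld_jimbo_relations h e f k kinv,
      forall (B : algType C) (eB fB kB kinvB : 'I_(rank g) -> B),
        drinfeld_jimbo_relations h eB fB kB kinvB ->
        let extends (phi : {lrmorphism U -> B}) :=
          forall i, [/\ phi (e i) = eB i, phi (f i) = fB i,
                        phi (k i) = kB i & phi (kinv i) = kinvB i] in
        exists2 phi, extends phi & forall psi, extends psi -> phi =1 psi,
      forall i, [/\ par (is_odd i) (e i) = e i, par (is_odd i) (f i) = f i,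
                    par false (k i) = k i & par false (kinv i) = kinv i]
    & forall i,
      [/\ [/\ tens_eq (comult (e i)) [:: (e i, 1); (k i, e i)],
              tens_eq (comult (f i)) [:: (f i, kinv i); (1, f i)],
              tens_eq (comult (k i)) [:: (k i, k i)]
            & tens_eq (comult (kinv i)) [:: (kinv i, kinv i)]],
          [/\ counit (e i) = 0, counit (f i) = 0, counit (k i) = 1
            & counit (kinv i) = 1]
        & [/\ antipode (e i) = - (kinv i * e i),
              antipode (f i) = - (f i * k i), antipode (k i) = kinv i
            & antipode (kinv i) = k i]]].

(* The Hopf subalgebra U_q(g_0) is given by an embedding iota: its image is
   generated by all k_i, k_i^(-1) and the even e_i, f_i. *)
Definition is_even_quantum_subalgebra (U0 : hopfSuperalgebra C)
    (iota : {lrmorphism U0 -> U}) : Prop :=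
  [/\ hopf_morphism iota, injective iota
    & range iota = generated_subalgebra
        [set x | exists i, [\/ x = k i, x = kinv i
                             | ~~ is_odd i /\ (x = e i \/ x = f i)]]].

End Quantum.
End QuantumSuperalgebra.

(* Main.v *)
From HB Require Import structures.
Require Import Defs.
From mathcomp Require Import ring.
Set Implicit Arguments.
Unset Strict Implicit.
Unset Printing Implicit Defensive.
Import Order.TTheory GRing.Theory Num.Theory.
Local Open Scope classical_set_scope.
Local Open Scope ring_scope.

(** Let [sigma] be the parity automorphism of U, which is 1 on the even and -1
    on the odd part.  On linear forms, [nu z] is the evaluation at [sigma z],
    the sign in [nu] being the one by which [sigma] acts.  Moreover, if I is a
    linear form on an algebra of functions B, then pairing the coproduct of b
    with evaluation at x and with I yields I of the left translate
    [y |-> b (x * y)], all signs of the super sign rule being absorbed by the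
    coproduct ([dual_prod_eval_mem]).  Two consequences follow.

    - I is a left integral iff I of the left translate of b by x is
      [counit x * I b].
    - The integral under consideration is
      [b |-> int0 (y |-> b (sigma z * iota y))].

    By left invariance of [int0], the form
    [w |-> int0 (y |-> b (sigma w * iota y))] vanishes on the left ideal J,
    since [sigma (x * iota u) = sigma x * iota (sigma u)] and the counit does
    not see [sigma] ([int0_left_ideal_J]).  It therefore depends only on the
    class of w modulo J, which is the independence of the representative.
    Translating b by x replaces [sigma z] by
    [x * sigma z = sigma (sigma x * z)], and [sigma x * z] is congruent to
    [counit x *: z] modulo J by the invariance of z, so the integral is
    multiplied by [counit x]. *)

Section LeftTranslation.
Variable K : fieldType.
Implicit Types H L : hopfSuperalgebra K.

(** * The parity automorphism *)

Definition parity_aut H (x : H) : H := par false x - par true x.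

HB.instance Definition _ H d :=
  GRing.isLinear.Build K H H *:%R (@par K H d) (par_linear d).

Lemma parity_aut_is_linear H : linear (@parity_aut H).
Proof.
by move=> a x y; rewrite /parity_aut !par_linear opprD scalerBr addrACA.
Qed.

HB.instance Definition _ H :=
  GRing.isLinear.Build K H H *:%R (@parity_aut H) (@parity_aut_is_linear H).

Lemma parity_aut_par H d (x : H) :
  parity_aut (par d x) = (-1) ^+ d *: par d x.
Proof.
by case: d; rewrite /parity_aut !par_proj /= ?sub0r ?subr0 ?scaleN1r ?scale1r.
Qed.

Lemma parity_autK H : involutive (@parity_aut H).
Proof.
move=> x; rewrite {2}/parity_aut linearB /= !parity_aut_par.
by rewrite /= scale1r expr1 scaleN1r opprK par_sum.
Qed.

(** A grading by Z_2 makes the sign of a homogeneous product the product of the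
    signs, so it suffices to expand both factors into even and odd parts. *)
Lemma parity_autM H (x y : H) :
  parity_aut (x * y) = parity_aut x * parity_aut y.
Proof.
have homog c d : parity_aut (par c x * par d y)
    = parity_aut (par c x) * parity_aut (par d y).
  have xyE : par (c (+) d) (par c x * par d y) = par c x * par d y.
    by apply: par_mul; rewrite par_proj eqxx.
  rewrite !parity_aut_par -scalerAl -scalerAr scalerA -signr_addb.
  by rewrite -[in LHS]xyE parity_aut_par xyE.
rewrite -(par_sum x) -(par_sum y).
have autD : {morph @parity_aut H : u v / u + v} by exact: linearD.
by rewrite mulrDl 2!mulrDr !autD !homog -2!mulrDr -mulrDl.
Qed.

Lemma counit0 H : counit (0 : H) = 0.
Proof.
have := counit_linear (-1) (0 : H) 0.
by rewrite scaler0 addr0 mulN1r addNr.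
Qed.

Lemma counit_parity_aut H (x : H) : counit (parity_aut x) = counit x.
Proof.
have odd0 y : counit (par true y : H) = 0.
  by rewrite -counit_par par_proj counit0.
rewrite /parity_aut addrC -scaleN1r counit_linear odd0 mulr0 add0r.
exact: counit_par.
Qed.

Lemma parity_aut_morph H L (phi : {lrmorphism H -> L}) :
  hopf_morphism phi -> forall x, phi (parity_aut x) = parity_aut (phi x).
Proof. by case=> phi_par _ _ _ x; rewrite {1}/parity_aut rmorphB /= !phi_par. Qed.

Lemma nu_eval H (a : H -> K) (z : H) :
  linear_for *%R a -> nu z a = a (parity_aut z).
Proof.
move=> a_lin; have a0 : a 0 = 0.
  by have := a_lin (-1) 0 0; rewrite scaler0 addr0 mulN1r addNr.
have -> : parity_aut z = -1 *: par true z + par false z.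
  by rewrite scaleN1r addrC.
by rewrite a_lin /nu !big_bool /dpar /= !par_proj /= a0; ring.
Qed.

(** * Left translation in an algebra of functions *)

(** The part of the structure of the functions on a quantum supergroup that
    the computation with the coproduct uses; it passes to restrictions. *)
Definition super_coalgebra_of_forms H (B : set (H -> K)) : Prop :=
  [/\ forall a, B a -> linear_for *%R a,
      B (fun=> 0),
      forall c a b, B a -> B b -> B (c \*o a \+ b),
      forall d a, B a -> B (dpar d a)
    & forall a, B a -> exists s, represents_dcomul B a s].

Definition left_translate H (x : H) (a : H -> K) : H -> K :=
  fun y => a (x * y).

Lemma finite_dual_linear H (a : H -> K) :
  finite_dual a -> linear_for *%R a.
Proof.
case=> r [u [v aE]] c x y.
by rewrite !aE rep_linear mulmxDr mulmxDl -scalemxAr -scalemxAl !mxE.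
Qed.

Lemma sub_hopf_super_coalgebra H (B : set (H -> K)) :
  sub_hopf_superalgebra B -> super_coalgebra_of_forms B.
Proof.
case=> Bdual [B1 Blin _] Bpar Bcomul _; split=> //.
  by move=> a /Bdual/finite_dual_linear.
have -> : (fun=> 0) = -1 \*o counit \+ counit :> (H -> K).
  by apply/funext => x /=; ring.
exact: Blin.
Qed.

Lemma restriction_super_coalgebra H L (iota : {lrmorphism L -> H})
    (B : set (H -> K)) :
  hopf_morphism iota -> super_coalgebra_of_forms B ->
  super_coalgebra_of_forms (restriction iota @` B).
Proof.
case=> iota_par _ _ _ [Bl B0 Blin Bpar Bcomul]; split.
- by move=> _ [a /Bl a_lin <-] c x y; rewrite /restriction /= linearP a_lin.
- by exists (fun=> 0).
- by move=> c _ _ [a Ba <-] [b Bb <-]; exists (c \*o a \+ b) => //; exact: Blin.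
- move=> d _ [a Ba <-]; exists (dpar d a); first exact: Bpar.
  by apply/funext => x; rewrite /restriction /dpar /= iota_par.
- move=> _ [a Ba <-]; have [s [sB sE]] := Bcomul a Ba.
  exists [seq (restriction iota u.1, restriction iota u.2) | u <- s]; split.
    by move=> _ /mapP[u /sB[? ?] ->]; split; [exists u.1 | exists u.2].
  move=> x y; rewrite big_map /restriction /= rmorphM -sE.
  by apply: eq_bigr => u _; rewrite /kpair !big_bool /= !iota_par.
Qed.

Section DualProduct.
Variables (H : hopfSuperalgebra K) (B : set (H -> K)) (I : (H -> K) -> K).
Hypotheses (B_coalg : super_coalgebra_of_forms B) (I_lin : linear_form_on B I).

Lemma linear_form_on_scale (c : K) (a : H -> K) :
  B a -> B (c \*o a) /\ I (c \*o a) = c * I a.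
Proof.
move: B_coalg => [_ B0 Blin _ _] Ba.
have -> : c \*o a = c \*o a \+ (fun=> 0) by apply/funext=> y; rewrite /= addr0.
have I0 : I (fun=> 0) = 0.
  have := I_lin (-1) B0 B0; rewrite mulN1r addNr => I0.
  by rewrite -[RHS]I0; congr I; apply/funext => y /=; ring.
by split; [exact: Blin | rewrite I_lin // I0 addr0].
Qed.

(** Membership and value are proved together because additivity of the form at
    each step needs the partial sum to lie in the subspace. *)
Lemma linear_form_on_sum (T : eqType) (s : seq T) (F : T -> H -> K)
    (v : T -> K) :
  (forall u, u \in s -> B (F u) /\ I (F u) = v u) ->
  B (fun y => \sum_(u <- s) F u y) /\
  I (fun y => \sum_(u <- s) F u y) = \sum_(u <- s) v u.
Proof.
move: B_coalg => [_ B0 Blin _ _].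
elim: s => [|u s IHs] Fs.
  have -> : (fun y => \sum_(u <- [::]) F u y) = 0 \*o (fun=> 0).
    by apply/funext => y; rewrite big_nil /= mul0r.
  by have [BZ ->] := linear_form_on_scale 0 B0; rewrite big_nil mul0r.
have [BF IF] := Fs u (mem_head u s).
have [|BS IS] := IHs.
  by move=> w ws; apply: Fs; rewrite inE ws orbT.
have -> : (fun y => \sum_(w <- u :: s) F w y)
    = 1 \*o F u \+ (fun y => \sum_(w <- s) F w y).
  by apply/funext => y; rewrite big_cons /= mul1r.
by split; [exact: Blin | rewrite I_lin // big_cons mul1r IF IS].
Qed.

(** The defining property of the coproduct of b, read as a function of its
    second argument, writes [left_translate x b] as a combination of elements of
    B with the very signs that occur in the pairing, so that applying I term by
    term leaves no sign. *)
Lemma dual_prod_eval_mem (x : H) (b : H -> K) : B b ->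
  B (left_translate x b) /\
  I (left_translate x b) = dual_prod B (fun a => a x) I b.
Proof.
move: B_coalg => [_ _ _ Bpar Bcomul] Bb.
have [sB sE] : represents_dcomul B b (dcomul B b).
  by have [s bs] := Bcomul b Bb; exact: xgetI bs.
have -> : left_translate x b = fun y => \sum_(u <- dcomul B b)
    \sum_(i : bool) \sum_(j : bool)
      ((-1) ^+ (i && j) * u.1 (par i x)) * dpar j u.2 y.
  apply/funext => y; rewrite /left_translate -sE.
  by rewrite /kpair; do 3!apply: eq_bigr => ? _; rewrite mulrA.
apply: linear_form_on_sum => u /sB[_ Bu2].
apply: linear_form_on_sum => i _; apply: linear_form_on_sum => j _.
by rewrite mulrA; exact/linear_form_on_scale/Bpar.
Qed.

Lemma left_translate_mem (x : H) (b : H -> K) :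
  B b -> B (left_translate x b).
Proof. by case/(dual_prod_eval_mem x). Qed.

Lemma dual_prod_eval (x : H) (b : H -> K) : B b ->
  dual_prod B (fun a => a x) I b = I (left_translate x b).
Proof. by case/(dual_prod_eval_mem x). Qed.

Lemma dual_prod_nu (z : H) (b : H -> K) : B b ->
  dual_prod B (nu z) I b = I (left_translate (parity_aut z) b).
Proof.
move=> Bb; rewrite -dual_prod_eval //.
move: B_coalg => [Bl _ _ Bpar Bcomul].
have [sB _] : represents_dcomul B b (dcomul B b).
  by have [s bs] := Bcomul b Bb; exact: xgetI bs.
rewrite /dual_prod; apply: eq_big_seq => u /sB[Bu1 _].
rewrite /kpair; do 2!apply: eq_bigr => ? _.
by rewrite nu_eval //; exact/Bl/Bpar.
Qed.

End DualProduct.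

Lemma left_integralE H (B : set (H -> K)) (I : (H -> K) -> K) :
  super_coalgebra_of_forms B -> linear_form_on B I ->
  left_integral B I <->
  forall b, B b -> forall x, I (left_translate x b) = I b * counit x.
Proof.
move=> B_coalg I_lin; split=> [[_ I_int] b Bb x|I_int].
  by rewrite -(dual_prod_eval B_coalg I_lin) //; exact: I_int.
by split=> // b Bb x; rewrite -I_int // -(dual_prod_eval B_coalg I_lin).
Qed.

(** * Integration over the even part *)

Section EvenIntegral.
Variables (H0 H : hopfSuperalgebra K) (iota : {lrmorphism H0 -> H}).
Variables (A : set (H -> K)) (int0 : (H0 -> K) -> K).
Hypotheses (iota_hopf : hopf_morphism iota).
Hypotheses (A_coalg : super_coalgebra_of_forms A).
Hypotheses (int0_int : left_integral (restriction iota @` A) int0).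

Let I0 : (H -> K) -> K := int0 \o restriction iota.

Let I0_lin : linear_form_on A I0.
Proof.
move: int0_int => [int0_lin _] c a b Aa Ab.
by apply: int0_lin; [exists a | exists b].
Qed.

Let translate_linear (a : H -> K) (c : K) (x y : H) : A a ->
  I0 (left_translate (c *: x + y) a)
    = c * I0 (left_translate x a) + I0 (left_translate y a).
Proof.
move=> Aa; have Amem w := left_translate_mem A_coalg I0_lin w Aa.
rewrite -I0_lin //; congr I0; apply/funext => w.
have [Al _ _ _ _] := A_coalg.
by rewrite /left_translate /= mulrDl -scalerAl Al.
Qed.

(** Restriction intertwines translation by [iota u] with translation by u, so
    left invariance of [int0] applies to the restricted translate by x. *)
Let translate_iota (a : H -> K) (x : H) (u : H0) : A a ->
  I0 (left_translate (x * iota u) a) = I0 (left_translate x a) * counit u.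
Proof.
move=> Aa; have [int0_lin _] := int0_int.
have Ae_coalg := restriction_super_coalgebra iota_hopf A_coalg.
move/(left_integralE Ae_coalg int0_lin): int0_int => <-; last first.
  exists (left_translate x a) => //.
  exact: (left_translate_mem A_coalg I0_lin).
congr int0; apply/funext => y.
by rewrite /restriction /left_translate /= rmorphM mulrA.
Qed.

(** The parity automorphism maps J to itself, and [translate_iota] kills every
    generator of J. *)
Lemma int0_left_ideal_J (a : H -> K) (w : H) : A a -> left_ideal_J iota w ->
  I0 (left_translate (parity_aut w) a) = 0.
Proof.
move=> Aa [s + ->].
elim: s => [|[x u] s IHs] s0.
  rewrite big_nil raddf0.
  have := translate_linear (-1) 0 0 Aa.
  by rewrite scaler0 addr0 mulN1r addNr.
rewrite big_cons /= linearD /= -[X in X + _]scale1r translate_linear //.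
rewrite IHs; last by move=> v vs; apply: s0; rewrite inE vs orbT.
rewrite parity_autM -parity_aut_morph // translate_iota // counit_parity_aut.
by rewrite (s0 (x, u)) ?mem_head // mulr0 mul1r addr0.
Qed.

Lemma int0_translate_mod_J (a : H -> K) (w z : H) (c : K) : A a ->
  left_ideal_J iota (w - c *: z) ->
  I0 (left_translate (parity_aut w) a)
    = c * I0 (left_translate (parity_aut z) a).
Proof.
move=> Aa wJ; rewrite -[w](subrK (c *: z)) addrC linearD linearZ /=.
by rewrite translate_linear // (int0_left_ideal_J Aa wJ) addr0.
Qed.

(** Translating by x first and by [parity_aut z] afterwards amounts to
    translating by the image under the parity automorphism of
    [parity_aut x * z], to which the invariance of z modulo J applies. *)
Lemma left_integral_dual_prod_nu (z : H) : invariant_mod_J iota z ->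
  left_integral A (dual_prod A (nu z) I0).
Proof.
move=> z_inv; have nuE := dual_prod_nu A_coalg I0_lin z.
have Amem x a := @left_translate_mem _ A I0 A_coalg I0_lin x a.
have I_lin : linear_form_on A (dual_prod A (nu z) I0).
  move=> c a b Aa Ab; have [_ _ Alin _ _] := A_coalg.
  by rewrite !nuE //; [rewrite -I0_lin //; exact: Amem | exact: Alin].
apply/(left_integralE A_coalg I_lin) => b Ab x.
rewrite !nuE //; last exact: Amem.
have -> : left_translate (parity_aut z) (left_translate x b)
    = left_translate (parity_aut (parity_aut x * z)) b.
  by apply/funext => y; rewrite /left_translate parity_autM parity_autK mulrA.
rewrite (int0_translate_mod_J Ab (z_inv (parity_aut x))).
by rewrite counit_parity_aut mulrC.
Qed.

Lemma dual_prod_nu_mod_J (z z' : H) (a : H -> K) :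
  left_ideal_J iota (z' - z) -> A a ->
  dual_prod A (nu z') I0 a = dual_prod A (nu z) I0 a.
Proof.
move=> zJ Aa; rewrite !(dual_prod_nu A_coalg I0_lin) //.
by rewrite (int0_translate_mod_J (z := z) (c := 1) Aa) ?mul1r // scale1r.
Qed.

End EvenIntegral.
End LeftTranslation.

Theorem theorem5 (R : realType) (g : basic_classical (complex R))
    (g_ok : admissible g) (h : complex R) (q_generic : generic g h)
    (U : hopfSuperalgebra (complex R)) (e f k kinv : 'I_(rank g) -> U)
    (U_def : is_quantum_superalgebra h e f k kinv)
    (U0 : hopfSuperalgebra (complex R)) (iota : {lrmorphism U0 -> U})
    (U0_def : is_even_quantum_subalgebra e f k kinv iota)
    (A : set (U -> complex R)) (A_fun : function_superalgebra A)
    (Ae_basis : peter_weyl_basis (restriction iota @` A))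
    (int0 : (U0 -> complex R) -> complex R)
    (int0_def : even_integral (restriction iota @` A) int0)
    (z : U) (z_inv : invariant_mod_J iota z) :
  left_integral A (dual_prod A (nu z) (int0 \o restriction iota)) /\
  (forall z' : U, left_ideal_J iota (z' - z) ->
     forall a, A a ->
       dual_prod A (nu z') (int0 \o restriction iota) a
       = dual_prod A (nu z) (int0 \o restriction iota) a).
Proof.
have [iota_hopf _ _] := U0_def.
have [A_hopf _ _] := A_fun.
have A_coalg := sub_hopf_super_coalgebra A_hopf.
have [int0_int _ _ _] := int0_def.
split; first exact: left_integral_dual_prod_nu.
by move=> z' zJ a Aa; exact: dual_prod_nu_mod_J.
Qed.
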